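(* Let $\mathcal{A}$ be a unital $C^*$-algebra, $\mathcal{H}$ a Hilbert $\mathcal{A}$-module, and $\mathbb{J}\subseteq\mathbb{N}$ a finite or countable index set. Let $\{T_i\}_{i\in\mathbb{J}}$ be an operator frame for $End_{\mathcal{A}}^{*}(\mathcal{H})$ with bounds $A$ and $B$. If $\{R_i\}_{i\in\mathbb{J}}\subset End_{\mathcal{A}}^{*}(\mathcal{H})$ is an operator Bessel sequence with a bound $M<A$, then $\{T_i+R_i\}_{i\in\mathbb{J}}$ and $\{T_i-R_i\}_{i\in\mathbb{J}}$ are operator frames for $End_{\mathcal{A}}^{*}(\mathcal{H})$.
   Context: Hilbert $\mathcal{A}$-modules are left modules with $\mathcal{A}$-valued inner product $\langle\cdot,\cdot\rangle$, $\mathcal{A}$-linear in the first variable, with $\langle x,y\rangle=\langle y,x\rangle^*$, complete for $\|x\|=\|\langle x,x\rangle\|^{1/2}$. $End_{\mathcal{A}}^{*}(\mathcal{H})$ is the set of adjointable operators on $\mathcal{H}$. Inequalities between elements of $\mathcal{A}$ refer to the usual order given by the positive cone of $\mathcal{A}$. A family $\{T_i\}_{i\in\mathbb{J}}\subset End_{\mathcal{A}}^{*}(\mathcal{H})$ is an operator frame for $End_{\mathcal{A}}^{*}(\mathcal{H})$ with (lower and upper) bounds $A,B>0$ if $A\langle x,x\rangle\le\sum_{i\in\mathbb{J}}\langle T_ix,T_ix\rangle\le B\langle x,x\rangle$ for all $x\in\mathcal{H}$. It is an operator Bessel sequence with bound $B>0$ if the upper inequality holds for all $x\in\mathcal{H}$.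 Convention: all series $\sum_{i\in\mathbb{J}}\langle T_ix,T_ix\rangle$ are taken to converge in norm in $\mathcal{A}$, i.e. $\{T_ix\}_{i\in\mathbb{J}}\in\ell^2(\mathcal{H})$, where $\ell^2(\mathcal{H})$ is the Hilbert $\mathcal{A}$-module of sequences $\{x_i\}_{i\in\mathbb{J}}$ in $\mathcal{H}$ with $\sum_i\langle x_i,x_i\rangle$ norm convergent; this convergence is part of the notions of operator frame and operator Bessel sequence. *)

(* Defs.v *)
From HB Require Import structures.
From mathcomp Require Import all_boot all_order all_algebra.
From mathcomp Require Import complex.
From mathcomp Require Import all_classical all_reals all_analysis.

Set Implicit Arguments.
Unset Strict Implicit.
Unset Printing Implicit Defensive.

Import Order.TTheory GRing.Theory Num.Theory.
Import numFieldNormedType.Exports.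

Local Open Scope classical_set_scope.
Local Open Scope ring_scope.
Local Open Scope complex_scope.

(* Unital C*-algebras over the complex numbers R[i].  The norm takes its values
   in R[i], where 0 <= z entails that z is real.  The product is part of the
   mixin because a structure joining a ring and a normed module would clash
   with numDomainType; 1 = 0 (the zero algebra) is allowed. *)
HB.mixin Record isCStarAlgebra (R : realType) A
    of CompleteNormedModule R[i] A := {
  cone : A ;
  cmul : A -> A -> A ;
  cstar : A -> A ;
  cmulA : associative cmul ;
  cmul1l : left_id cone cmul ;
  cmul1r : right_id cone cmul ;
  cmulDl : left_distributive cmul +%R ;
  cmulDr : right_distributive cmul +%R ;
  cscaleAl : forall (l : R[i]) (a b : A), l *: cmul a b = cmul (l *: a) b ;
  cscaleAr : forall (l : R[i]) (a b : A), l *: cmul a b = cmul a (l *: b) ;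
  cnormM : forall a b : A, `|cmul a b| <= `|a| * `|b| ;
  cstarK : involutive cstar ;
  cstarD : {morph cstar : a b / a + b} ;
  cstarZ : forall (l : R[i]) (a : A), cstar (l *: a) = Num.conj l *: cstar a ;
  cstarM : forall a b : A, cstar (cmul a b) = cmul (cstar b) (cstar a) ;
  cnormK : forall a : A, `|cmul (cstar a) a| = `|a| ^+ 2 }.

#[short(type="cstarAlgType")]
HB.structure Definition CStarAlgebra (R : realType) :=
  {A of CompleteNormedModule R[i] A & isCStarAlgebra R A}.

(* The same carrier, seen as a ring. *)
Definition cring (R : realType) (A : cstarAlgType R) : Type := A.

HB.instance Definition _ (R : realType) (A : cstarAlgType R) :=
  GRing.Zmodule.copy (cring A) A.

HB.instance Definition _ (R : realType) (A : cstarAlgType R) :=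
  GRing.Zmodule_isPzRing.Build (cring A)
    cmulA cmul1l cmul1r cmulDl cmulDr.

Section CStarOrder.
Context {R : realType} {A : cstarAlgType R}.

Definition cinvertible (a : A) : Prop := exists b : A, cmul a b = cone /\ cmul b a = cone.

Definition cspectrum (a : A) : set R[i] := [set l | ~ cinvertible (l *: cone - a)].

Definition cpositive (a : A) : Prop :=
  cstar a = a /\ forall l : R[i], cspectrum a l -> 0 <= l.

Definition cle (a b : A) : Prop := cpositive (b - a).

End CStarOrder.

(* A pre-Hilbert module.  The complex vector space structure is l.x := (l.1) *: x,
   so only the A-module structure is part of the data. *)
HB.mixin Record isPreHilbertModule (R : realType) (A : cstarAlgType R) H
    of GRing.Lmodule (cring A) H := {
  hip : H -> H -> A ;
  hipDl : forall x y z : H, hip (x + y) z = hip x z + hip y z ;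
  hipZl : forall (a : cring A) (x y : H), hip (a *: x) y = cmul a (hip x y) ;
  hipC : forall x y : H, hip x y = cstar (hip y x) ;
  hip_ge0 : forall x : H, cpositive (hip x x) ;
  hip_eq0 : forall x : H, hip x x = 0 -> x = 0 }.

#[short(type="preHilbertModType")]
HB.structure Definition PreHilbertModule (R : realType) (A : cstarAlgType R) :=
  {H of GRing.Lmodule (cring A) H & isPreHilbertModule R A H}.

Definition hnorm (R : realType) (A : cstarAlgType R) (H : preHilbertModType A)
    (x : H) : R[i] := sqrtC `|hip x x|.

HB.mixin Record isHilbertModule (R : realType) (A : cstarAlgType R) H
    of PreHilbertModule R A H := {
  hcomplete : forall u : nat -> H,
    (forall e : R[i], 0 < e -> exists N : nat, forall m n : nat,
       (N <= m)%N -> (N <= n)%N -> hnorm (u m - u n) < e) ->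
    exists x : H, forall e : R[i], 0 < e -> exists N : nat, forall n : nat,
       (N <= n)%N -> hnorm (u n - x) < e }.

#[short(type="hilbertModType")]
HB.structure Definition HilbertModule (R : realType) (A : cstarAlgType R) :=
  {H of PreHilbertModule R A H & isHilbertModule R A H}.

Section OperatorFrames.
Context {R : realType} {A : cstarAlgType R} {H : hilbertModType A}.

(* A map with an adjoint is automatically A-linear and bounded. *)
Definition adjointable : set (H -> H) :=
  [set T | exists S : H -> H, forall x y : H, hip (T x) y = hip x (S y)].

(* A family indexed by J is given by a sequence, whose values outside J are
   irrelevant. *)
Definition ip_psum (J : set nat) (x : nat -> H) (n : nat) : A :=
  \sum_(0 <= i < n | i \in J) hip (x i) (x i).

Definition ell2 (J : set nat) (x : nat -> H) : Prop := cvgn (ip_psum J x).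

Definition ip_sum (J : set nat) (x : nat -> H) : A := limn (ip_psum J x).

Definition operator_bessel_bound (J : set nat) (T : nat -> H -> H) (b : R) :
    Prop :=
  [/\ 0 < b,
      forall i, J i -> adjointable (T i) &
      forall x : H, ell2 J (fun i => T i x) /\
        cle (ip_sum J (fun i => T i x)) (b%:C *: hip x x)].

Definition operator_frame_bounds (J : set nat) (T : nat -> H -> H) (a b : R) :
    Prop :=
  [/\ 0 < a, 0 < b,
      forall i, J i -> adjointable (T i) &
      forall x : H, [/\ ell2 J (fun i => T i x),
        cle (a%:C *: hip x x) (ip_sum J (fun i => T i x)) &
        cle (ip_sum J (fun i => T i x)) (b%:C *: hip x x)]].

Definition operator_frame (J : set nat) (T : nat -> H -> H) : Prop :=
  exists a b : R, operator_frame_bounds J T a b.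

End OperatorFrames.

(* Main.v *)
Require Import Defs.
From HB Require Import structures.
From mathcomp Require Import all_boot all_order all_algebra complex ring lra.
From mathcomp Require Import all_classical all_reals all_analysis.

Set Implicit Arguments.
Unset Strict Implicit.
Unset Printing Implicit Defensive.

Import Order.TTheory GRing.Theory Num.Theory.
Import numFieldNormedType.Exports.

Local Open Scope classical_set_scope.
Local Open Scope ring_scope.
Local Open Scope complex_scope.

(** Everything reduces to the order of the C*-algebra.  For vectors [u], [v]
    and a real [s], [<su + v, su + v> >= 0] rewrites as
    [s <u + v, u + v> + (1 - s) <v, v> - (s - s^2) <u, u> >= 0]; summing over
    the family with [s = -1] gives the upper bound [2 (b + m)], and with
    [s = (a + m) / (2 a)] a positive lower bound.

    With positivity defined by the spectrum, what needs work is that positive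
    elements form a closed cone on which the norm is monotone.  This follows
    from "[h] is positive iff [|t - h| <= t]" for a self-adjoint [h] and
    [t >= |h|], hence from the fact that the norm of a self-adjoint element is
    its spectral radius.  The latter is obtained as in Rickart's elementary
    proof of the spectral radius formula: if [k = k*] has norm 1 and [1 - k],
    [1 + k] are invertible, then [(1 - w k)^-1] is bounded uniformly on
    [|w| = 1], so for [s < 1] close to 1 it is uniformly close to
    [(1 - w s k)^-1].  Averaging over square roots of unity transfers this to
    [k^(2^n)] and [(s k)^(2^n)]; the latter tends to 0, contradicting
    [|k^(2^n)| = 1]. *)

(** Puts complex scaling on the ring view of the algebra, so that products and complex multiples
    live on one type. *)
HB.instance Definition _ (R : realType) (A : cstarAlgType R) :=
  GRing.Lmodule.copy (cring A) A.

Lemma normcRe (R : realType) (z : R[i]) : `|z| = (complex.Re `|z|)%:C.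
Proof. by rewrite normc_def. Qed.

Lemma exprn_small (R : realType) (r e : R) :
  0 <= r < 1 -> 0 < e -> exists n, forall m, (n <= m)%N -> r ^+ m <= e.
Proof.
move=> /andP[r0 r1] e0.
have /cvg_geometric/cvgrPdist_le/(_ e e0) : `|r| < 1 by rewrite ger0_norm.
move=> /(_ 1)[n _ nP]; exists n => m nm.
have := nP m nm; rewrite /= sub0r normrN mul1r ger0_norm // exprn_ge0 //.
Qed.

(** * Real-valued norm, involution and convergence *)

Section RealNorm.
Context {R : realType} {A : cstarAlgType R}.
Implicit Types (a b c : cring A) (l : R[i]) (r : R).

(** The norm of [A] is a real element of [R[i]]; taking its real part loses nothing and gives
    inequalities over the ordered field [R]. *)
Definition rnorm (a : cring A) : R := complex.Re `|a : A|.

Lemma rnormE (a : A) : `|a| = (rnorm a)%:C.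
Proof. by rewrite RRe_real // normr_real. Qed.

Lemma rnorm_ge0 a : 0 <= rnorm a.
Proof. by rewrite -ler0c -rnormE. Qed.

Lemma rnorm0 : rnorm 0 = 0.
Proof. by rewrite /rnorm normr0. Qed.

Lemma rnorm_eq0 a : rnorm a = 0 -> a = 0.
Proof. by move=> a0; apply: (@normr0_eq0 _ A); rewrite rnormE a0. Qed.

Lemma rnormD a b : rnorm (a + b) <= rnorm a + rnorm b.
Proof. by rewrite -lecR rmorphD /= -!rnormE; exact: ler_normD. Qed.

Lemma rnormN a : rnorm (- a) = rnorm a.
Proof. by rewrite /rnorm normrN. Qed.

Lemma rnormB a b : rnorm (a - b) <= rnorm a + rnorm b.
Proof. by rewrite -[rnorm b]rnormN rnormD. Qed.

Lemma rnorm_distC a b : rnorm (a - b) = rnorm (b - a).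
Proof. by rewrite -rnormN opprB. Qed.

Lemma rnorm_distD c a b : rnorm (a - b) <= rnorm (a - c) + rnorm (c - b).
Proof. by rewrite -[a - b](subrKA c) rnormD. Qed.

Lemma rnormM a b : rnorm (a * b) <= rnorm a * rnorm b.
Proof. by rewrite -lecR rmorphM /= -!rnormE; exact: cnormM. Qed.

Lemma rnormZ l a : rnorm (l *: a) = complex.Re `|l| * rnorm a.
Proof.
by apply: complexI; rewrite rmorphM /= -rnormE -normcRe -rnormE; exact: normrZ.
Qed.

Lemma rnormZR r a : rnorm (r%:C *: a) = `|r| * rnorm a.
Proof. by rewrite rnormZ normc_def /= expr0n addr0 sqrtr_sqr. Qed.

Lemma scaler_mull l a b : l *: (a * b) = (l *: a) * b.
Proof. exact: cscaleAl. Qed.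

Lemma scaler_mulr l a b : l *: (a * b) = a * (l *: b).
Proof. exact: cscaleAr. Qed.

Definition star (a : cring A) : cring A := cstar a.

Lemma starK : involutive star. Proof. exact: cstarK. Qed.

Lemma starD : {morph star : a b / a + b}. Proof. exact: cstarD. Qed.

Lemma starM a b : star (a * b) = star b * star a.
Proof. exact: cstarM. Qed.

Lemma starZ l a : star (l *: a) = Num.conj l *: star a.
Proof. exact: cstarZ. Qed.

Lemma conjRC r : Num.conj r%:C = r%:C.
Proof. by apply/CrealP/complex_realP; exists r. Qed.

Lemma starZR r a : star (r%:C *: a) = r%:C *: star a.
Proof. by rewrite starZ conjRC. Qed.

Lemma starN : {morph star : a / - a}.
Proof. by move=> a; have := starZR (-1) a; rewrite rmorphN1 !scaleN1r. Qed.

Lemma starB : {morph star : a b / a - b}.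
Proof. by move=> a b; rewrite starD starN. Qed.

Lemma star1 : star 1 = 1.
Proof. by have := starM (star 1) 1; rewrite mulr1 starK mulr1. Qed.

Lemma rnorm_starM a : rnorm (star a * a) = rnorm a ^+ 2.
Proof.
apply: complexI; rewrite rmorphXn /= -rnormE -rnormE; exact: cnormK.
Qed.

(** The C*-identity gives [|b|^2 = |b* b| <= |b*| |b|]; divide by [|b|], then use that the star is
    an involution. *)
Lemma rnorm_star a : rnorm (star a) = rnorm a.
Proof.
suff le_star b : rnorm b <= rnorm (star b).
  by apply/eqP; rewrite eq_le le_star andbT -{2}[a]starK le_star.
have [b0|b0] := eqVneq (rnorm b) 0; first by rewrite b0 rnorm_ge0.
have b_gt0 : 0 < rnorm b by rewrite lt_def b0 rnorm_ge0.
by rewrite -(ler_pM2r b_gt0) -expr2 -rnorm_starM rnormM.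
Qed.

(** [|1|^2 = |1|] leaves 0 or 1, the former in the zero algebra; hence only an inequality. *)
Lemma rnorm1_le1 : rnorm 1 <= 1.
Proof.
have := rnorm_starM 1; rewrite star1 mulr1 => /esym/eqP.
rewrite -subr_eq0 expr2 -{3}[rnorm 1]mulr1 -mulrBr mulf_eq0 subr_eq0.
by case/orP => /eqP ->.
Qed.

Lemma rnormX a n : rnorm (a ^+ n) <= rnorm a ^+ n.
Proof.
elim: n => [|n IHn]; first by rewrite !expr0 rnorm1_le1.
by rewrite !exprS (le_trans (rnormM _ _))// ler_wpM2l// rnorm_ge0.
Qed.

Lemma cvgn_rnormP (u : nat -> A) (l : A) : u @ \oo --> l <->
  forall e : R, 0 < e -> exists n, forall m, (n <= m)%N -> rnorm (u m - l) <= e.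
Proof.
split=> [/cvgrPdist_le ul e e0|ul].
  have /ul[n _ nP] : 0 < e%:C by rewrite ltcR.
  by exists n => m /nP; rewrite /= rnormE lecR rnorm_distC.
apply/cvgrPdist_le => e e0.
have eE : e = (complex.Re e)%:C by rewrite RRe_real// gtr0_real.
have /ul[n nP] : 0 < complex.Re e by rewrite -ltcR -eE.
by exists n => // m /= /nP; rewrite eE rnormE lecR rnorm_distC.
Qed.

Lemma is_cvgn_rnormP (u : nat -> A) : cvgn u <->
  forall e : R, 0 < e ->
    exists n, forall m, (n <= m)%N -> rnorm (u m - u n) <= e.
Proof.
split=> [/cvgn_rnormP ul e e0|ucauchy].
  have [|n nP] := ul (e / 2); first by rewrite divr_gt0.
  exists n => m nm; apply: le_trans (rnorm_distD (lim (u @ \oo)) _ _) _.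
  by rewrite [e]splitr lerD ?nP// rnorm_distC nP.
apply: cauchy_cvg; apply: cauchy_exP => e e0.
have eE : e = (complex.Re e)%:C by rewrite RRe_real// gtr0_real.
have e0R : 0 < complex.Re e by rewrite -ltcR -eE.
have [|n nP] := ucauchy (complex.Re e / 2); first by rewrite divr_gt0.
exists (u n), n => // m /= /nP unm.
rewrite -ball_normE /ball_ /= rnormE eE ltcR rnorm_distC.
by rewrite (le_lt_trans unm)// ltr_pdivrMr// ltr_pMr// ltrDl.
Qed.

Lemma rnorm_lim_le (u : nat -> A) (l : A) (a : cring A) (c : R) n :
  u @ \oo --> l -> (forall m, (n <= m)%N -> rnorm (a - u m) <= c) ->
  rnorm (a - l) <= c.
Proof.
move=> /cvgn_rnormP ul uc; apply/ler_addgt0Pr => e /ul[k kP].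
apply: le_trans (rnorm_distD (u (maxn n k)) _ _) _.
by rewrite lerD ?uc ?kP ?leq_maxl ?leq_maxr.
Qed.

(** * Inverses, the Neumann series and perturbation *)

Definition inverses (x y : cring A) := x * y = 1 /\ y * x = 1.

(** The inverse is the limit of the geometric partial sums [s n], which form a Cauchy sequence. *)
Lemma neumann (x : cring A) : rnorm x < 1 ->
  exists y, inverses (1 - x) y /\ rnorm y <= (1 - rnorm x)^-1.
Proof.
set r := rnorm x => r1; have r0 : 0 <= r := rnorm_ge0 x.
have r1' : 0 < 1 - r by rewrite subr_gt0.
pose s n : cring A := \sum_(i < n) x ^+ i.
(* The right-hand side is the closed form of [r^n + ... + r^(n+m-1)]; keeping the factor [1 - r^m]
   makes the induction close. *)
have ds n m : rnorm (s (n + m)%N - s n) <= r ^+ n / (1 - r) * (1 - r ^+ m).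
  elim: m => [|m IHm]; first by rewrite addn0 subrr rnorm0 expr0 subrr mulr0.
  have -> : s (n + m.+1)%N - s n = (s (n + m)%N - s n) + x ^+ (n + m).
    by rewrite addnS /s big_ord_recr /= addrAC.
  rewrite (le_trans (rnormD _ _))// (le_trans (lerD IHm (rnormX _ _)))//.
  rewrite -/r exprD exprS le_eqVlt; apply/orP; left; apply/eqP; field.
  by rewrite gt_eqF.
have ds' n m : (n <= m)%N -> rnorm (s m - s n) <= r ^+ n / (1 - r).
  move=> /subnKC <-; rewrite (le_trans (ds _ _))// ler_piMr// ?gerBl
    ?exprn_ge0//.
  by rewrite divr_ge0 ?exprn_ge0// ltW.
have small e : 0 < e -> exists n, forall m, (n <= m)%N -> r ^+ m / (1 - r) <= e.
  move=> e0; have [||n nP] := @exprn_small R r (e * (1 - r)).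
  - by rewrite r0.
  - by rewrite mulr_gt0.
  by exists n => m /nP; rewrite ler_pdivrMr.
have cv : cvgn (s : nat -> A).
  by apply/is_cvgn_rnormP => e /small[n nP]; exists n => m /ds' /le_trans ->
    //; exact: nP.
pose y : cring A := limn (s : nat -> A).
have sy n : rnorm (s n - y) <= r ^+ n / (1 - r).
  by apply: (rnorm_lim_le (n := n) cv) => m nm; rewrite rnorm_distC ds'.
have y_le : rnorm y <= (1 - r)^-1.
  by have := sy 0; rewrite /s big_ord0 sub0r rnormN expr0 div1r.
have sl n : (1 - x) * s n = 1 - x ^+ n by rewrite -opprB mulNr -subrX1 opprB.
have sr n : s n * (1 - x) = 1 - x ^+ n.
  rewrite -sl; apply/esym/commr_sum => i _; apply/commr_sym/commrB.
    exact: commr1.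
  exact/commr_sym/commrX.
(* Adds the two errors met below: [r^n] from the power of [x], and the tail of the series times the
   bound [1 + r] on [1 - x]. *)
have bound n : r ^+ n + r ^+ n / (1 - r) * (1 + r) = r ^+ n / (1 - r) * 2.
  by field; rewrite gt_eqF.
have N1x : rnorm (1 - x) <= 1 + r.
  by rewrite (le_trans (rnormB _ _))// lerD ?rnorm1_le1.
have lim0 a : (forall n, rnorm a <= r ^+ n / (1 - r) * 2) -> a = 0.
  move=> a_le; apply: rnorm_eq0; apply/eqP; rewrite eq_le rnorm_ge0 andbT.
  apply/ler_addgt0Pr => e e0; rewrite add0r.
  have [|n nP] := small (e / 2); first by rewrite divr_gt0.
  by rewrite (le_trans (a_le n))// -ler_pdivlMr// nP.
exists y; split=> //; split; apply/eqP; rewrite -subr_eq0; apply/eqP; apply: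
  lim0 => n.
- have -> : (1 - x) * y - 1 = - (x ^+ n) - (1 - x) * (s n - y).
    by rewrite mulrBr sl !opprB addrCA addKr.
  rewrite (le_trans (rnormB _ _))// rnormN -bound lerD ?rnormX//.
  by rewrite (le_trans (rnormM _ _))// mulrC ler_pM ?rnorm_ge0.
- have -> : y * (1 - x) - 1 = - (x ^+ n) - (s n - y) * (1 - x).
    by rewrite mulrBl sr !opprB addrCA addKr.
  rewrite (le_trans (rnormB _ _))// rnormN -bound lerD ?rnormX//.
  by rewrite (le_trans (rnormM _ _))// ler_pM ?rnorm_ge0.
Qed.

Implicit Types (x y z : cring A).

Lemma inverses_sym x y : inverses x y -> inverses y x.
Proof. by case. Qed.

Lemma inverses_uniq x y z : inverses x y -> inverses x z -> y = z.
Proof. by move=> [_ yx] [xz _]; rewrite -[y]mulr1 -xz mulrA yx mul1r. Qed.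

Lemma inversesM x x' y y' :
  inverses x x' -> inverses y y' -> inverses (x * y) (y' * x').
Proof.
move=> [xx' x'x] [yy' y'y]; split.
  by rewrite mulrA -(mulrA x) yy' mulr1.
by rewrite mulrA -(mulrA y') x'x mulr1.
Qed.

Lemma inversesZ l x y : l != 0 -> inverses x y -> inverses (l *: x) (l^-1 *: y).
Proof.
move=> l0 [xy yx]; split; rewrite -scaler_mull -scaler_mulr scalerA ?xy ?yx.
  by rewrite divff// scale1r.
by rewrite mulVf// scale1r.
Qed.

Lemma inverses_star x y : inverses x y -> inverses (star x) (star y).
Proof. by move=> [xy yx]; split; rewrite -starM ?xy ?yx star1. Qed.

(** The resolvent identity. *)
Lemma inverses_sub x y x' y' :
  inverses x y -> inverses x' y' -> y - y' = y * (x' - x) * y'.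
Proof.
by move=> [_ yx] [xy' _]; rewrite mulrBr mulrBl -mulrA xy' mulr1 yx mul1r.
Qed.

(** Factor [x' = x (1 - z)] with [z = y (x - x')]. Then [|z| <= 1/2], and the Neumann series inverts
    [1 - z] with norm at most 2. *)
Lemma inverses_perturb x y x' (c : R) :
    inverses x y -> rnorm y <= c -> rnorm (x' - x) * c <= 2^-1 ->
  exists y', inverses x' y' /\ rnorm y' <= 2 * c.
Proof.
move=> xy yc xc; pose z := y * (x - x').
have z_le : rnorm z <= 2^-1.
  rewrite (le_trans (rnormM _ _))// (le_trans _ xc)// mulrC rnorm_distC.
  by rewrite ler_wpM2l// rnorm_ge0.
have [|w [zw w_le]] := @neumann z; first by rewrite (le_lt_trans z_le)//; lra.
have x'E : x' = x * (1 - z).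
  by rewrite mulrBr mulr1 mulrA (proj1 xy) mul1r opprB addrC subrK.
exists (w * y); rewrite x'E; split; first exact: inversesM.
rewrite (le_trans (rnormM _ _))// ler_pM ?rnorm_ge0// (le_trans w_le)//.
by rewrite -[leRHS]invrK lef_pV2 ?posrE//; lra.
Qed.

(** Partial fractions for [1 - x^2 = (1 - x)(1 + x)]. *)
Lemma inverses_1subsqr x y z : inverses (1 - x) y -> inverses (1 + x) z ->
  inverses (1 - x ^+ 2) (2^-1%:C *: (y + z)).
Proof.
move=> [xy yx] [xz zx].
have e1 : 1 - x ^+ 2 = (1 + x) * (1 - x).
  by rewrite mulrBr mulr1 mulrDl mul1r -expr2 opprD addrA addrK.
have e2 : 1 - x ^+ 2 = (1 - x) * (1 + x).
  by rewrite mulrDr mulr1 mulrBl mul1r -expr2 addrA subrK.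
have half : 2^-1%:C *: ((1 + x) + (1 - x)) = 1 :> cring A.
  rewrite addrACA subrr addr0 scalerDr -scalerDl -rmorphD.
  by have -> : 2^-1 + 2^-1 = 1 :> R; [field | rewrite rmorph1 scale1r].
split.
  rewrite -scaler_mulr mulrDr {1}e1 e2 -!mulrA xy xz !mulr1; exact: half.
by rewrite -scaler_mull mulrDl {1}e2 e1 !mulrA yx zx !mul1r addrC [X in _ *:
  X]addrC half.
Qed.

(** * Resolvents of self-adjoint elements off the real axis *)

Local Notation sc l := (l *: (1 : cring A)).

Lemma star_scalar l : star (sc l) = sc (Num.conj l).
Proof. by rewrite starZ star1. Qed.

Definition ci (t : R) : R[i] := Complex 0 t.

Lemma conj_ci t : Num.conj (ci t) = - ci t.
Proof. by rewrite /ci /Num.conj/=; simpc. Qed.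

Lemma norm_ci t : complex.Re `|ci t| = `|t|.
Proof. by rewrite normc_def /= expr0n add0r sqrtr_sqr. Qed.

Lemma ciM s t : ci s * ci t = - (s * t)%:C.
Proof. by rewrite /ci; simpc. Qed.

(* Adding [i t] with [t] large: [|h + i t|^2 <= |h|^2 + t^2 < (1 + t)^2], so
   [i (1 + t) - (h + i t)] is invertible.  For the bound, the inverse [y]
   satisfies [y - y* = - 2 i y y*], whence [2 |y|^2 <= 2 |y|]. *)
Lemma selfadj_sub_i (h : cring A) : star h = h ->
  exists y, inverses (sc (ci 1) - h) y /\ rnorm y <= 1.
Proof.
move=> hh; set t : R := rnorm h ^+ 2.
have t0 : 0 <= t by rewrite exprn_ge0// rnorm_ge0.
have t1 : 0 < 1 + t by rewrite ltr_pwDl.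
pose x := h + sc (ci t).
have xx : star x * x = h * h + sc (t ^+ 2)%:C.
  rewrite /x starD hh star_scalar conj_ci scaleNr mulrBl !mulrDr.
  rewrite -!scaler_mulr -!scaler_mull !mulr1 !mul1r scalerA ciM scaleNr.
  by rewrite addrKA opprK.
have x_lt : rnorm x < 1 + t.
  rewrite -(ltr_pXn2r (ltn0Sn 1)) ?nnegrE ?rnorm_ge0 ?(ltW t1)// -rnorm_starM
    xx.
  rewrite (le_lt_trans (rnormD _ _))//.
  have := rnorm_starM h; rewrite hh => ->; rewrite -/t rnormZR.
  rewrite ger0_norm ?sqr_ge0//; have := rnorm1_le1; have := rnorm_ge0 1.
  by move: t0; clear; nra.
have t1' : ci (1 + t) != 0.
  by apply/eqP => /(congr1 (@complex.Im R))/= /eqP; rewrite gt_eqF.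
have [|w [xw _]] := @neumann ((ci (1 + t))^-1 *: x).
  rewrite rnormZ normfV.
  have -> : complex.Re (`|ci (1 + t)|^-1) = (1 + t)^-1.
    by rewrite normcRe norm_ci gtr0_norm// -fmorphV.
  by rewrite mulrC ltr_pdivrMr// mul1r.
exists ((ci (1 + t))^-1 *: w).
set y := _ *: w.
have hy : inverses (sc (ci 1) - h) y.
  have -> : sc (ci 1) - h = ci (1 + t) *: (1 - (ci (1 + t))^-1 *: x).
    rewrite scalerBr scalerA divff// scale1r /x opprD addrA addrAC -scalerBl.
    by congr (_ *: _ - _); rewrite /ci; simpc; rewrite addrK.
  exact: inversesZ.
split=> //.
have hy' := inverses_star hy; rewrite starB hh star_scalar conj_ci in hy'.
have dy := inverses_sub hy hy'.
have {}dy : y - star y = ci (-2) *: (star (star y) * star y).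
  rewrite dy starK opprB subrKA -scalerBl -scaler_mulr mulr1.
  by rewrite -scaler_mull; congr (_ *: _); rewrite /ci; simpc; congr Complex;
    ring.
have /eqP := congr1 rnorm dy; rewrite rnormZ norm_ci rnorm_starM rnorm_star.
rewrite normrN normr_nat => /eqP yy; have := rnormB y (star y).
rewrite yy rnorm_star; have := rnorm_ge0 y; clear; nra.
Qed.

(** For [l = r + i s], the self-adjoint element [h' = (h - r) / s] satisfies [l - h = s (i - h')],
    which reduces to the point [i]. *)
Lemma selfadj_resolvent (h : cring A) l : star h = h -> complex.Im l != 0 ->
  exists y, inverses (sc l - h) y /\ rnorm y <= `|complex.Im l|^-1.
Proof.
case: l => r s /= hh s0.
have sC0 : s%:C != 0 by apply: contraNneq s0 => /complexI ->.
pose h' : cring A := (s^-1)%:C *: (h - sc r%:C).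
have h'h' : star h' = h' by rewrite /h' starZR starB hh starZR star1.
have [y [h'y y1]] := selfadj_sub_i h'h'.
exists ((s%:C)^-1 *: y); split.
  have -> : sc (r +i* s) - h = s%:C *: (sc (ci 1) - h').
    rewrite /h' scalerBr !scalerA -rmorphM divff// scale1r opprB addrA.
    by rewrite -scalerDl; congr (_ *: _ - _); rewrite /ci; simpc.
  exact: inversesZ.
by rewrite -fmorphV rnormZR normfV ler_piMr.
Qed.

End RealNorm.

(** * Norm and spectral radius of self-adjoint elements *)

Section Spectrum.
Context {R : realType} {A : cstarAlgType R}.
Implicit Types (a b h k x y z : cring A) (l w : R[i]) (r t : R).

Local Notation sc l := (l *: (1 : cring A)).

Lemma norm_complex_le (z : R[i]) t : 0 <= t ->
  complex.Re z ^+ 2 + complex.Im z ^+ 2 <= t ^+ 2 -> complex.Re `|z| <= t.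
Proof.
move=> t0 zt; rewrite normc_def /= -[leRHS]ger0_norm// -sqrtr_sqr.
by rewrite ler_wsqrtr.
Qed.

Lemma unimodular_ReIm w : `|w| = 1 -> complex.Re w ^+ 2 + complex.Im w ^+ 2 = 1.
Proof. by move=> w1; apply: complexI; rewrite add_Re2_Im2 w1 expr1n. Qed.

(** Asking for the whole unit circle lets the bound pass to squares: both square roots of [w] lie on
    the circle again. *)
Definition uniformly_close a b (e : R) := forall w, `|w| = 1 ->
  exists y z, [/\ inverses (1 - w *: a) y, inverses (1 - w *: b) z &
    rnorm (y - z) <= e].

(* [(1 - v^2 x^2)^-1] is the mean of [(1 - v x)^-1] and [(1 + v x)^-1]. *)
Lemma uniformly_closeX a b e n : uniformly_close a b e ->
  uniformly_close (a ^+ (2 ^ n)) (b ^+ (2 ^ n)) e.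
Proof.
elim: n => // n IHn ab; rewrite expnSr !exprM.
move: (a ^+ (2 ^ n)) (b ^+ (2 ^ n)) (IHn ab) => {ab IHn}a {}b ab w w1.
pose v := sqrtc w; have vw : v ^+ 2 = w by exact: sqr_sqrtc.
have v1 : `|v| = 1.
  by apply/eqP; rewrite -(@pexpr_eq1 _ _ 2)//; rewrite -normrX vw w1.
have [y [z [ay bz yz]]] := ab _ v1.
have [|y' [z' [ay' bz' yz']]] := ab (- v); first by rewrite normrN.
have sqE x : w *: x ^+ 2 = (v *: x) ^+ 2.
  by rewrite -vw !expr2 -scaler_mull -scaler_mulr scalerA.
rewrite scaleNr opprK in ay'; rewrite scaleNr opprK in bz'.
exists (2^-1%:C *: (y + y')), (2^-1%:C *: (z + z')); split.
- by rewrite sqE; exact: inverses_1subsqr.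
- by rewrite sqE; exact: inverses_1subsqr.
rewrite -scalerBr opprD addrACA rnormZR ger0_norm//.
have := rnormD (y - z) (y' - z'); lra.
Qed.

Lemma selfadj_rnormX h n : star h = h -> rnorm (h ^+ (2 ^ n)) = rnorm h ^+ (2 ^
  n).
Proof.
move=> hh; elim: n => [|n IHn]; first by rewrite !expr1.
rewrite expnSr !exprM -IHn -rnorm_starM expr2; congr (rnorm (_ * _)).
(* Powers of [h] are self-adjoint, so the C*-identity computes the norm of the square. *)
elim: (2 ^ n)%N => [|m IHm]; first by rewrite expr0 star1.
by rewrite exprSr starM hh -IHm -exprS -exprSr.
Qed.

(** On the right half of the circle [|1 - w| <= 2 |Im w|], so [1 - w k] is within [1 / (2 c)] of
    [1 - k] and [inverses_perturb] applies. *)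
Lemma inverses_near1 k w x (c : R) : `|w| = 1 -> 0 <= complex.Re w ->
    rnorm k <= 1 -> inverses (1 - k) x -> 1 <= c -> rnorm x <= c ->
    `|complex.Im w| < (4 * c)^-1 ->
  exists y, inverses (1 - w *: k) y /\ rnorm y <= 2 * c.
Proof.
move=> /unimodular_ReIm; case: w => r s /= rs r0 k1 kx c1 xc s_lt.
apply: inverses_perturb kx xc _.
have -> : 1 - (r +i* s) *: k - (1 - k) = (1 - (r +i* s)) *: k.
  by rewrite opprB addrC subrKA scalerBl scale1r.
have w_le : complex.Re `|1 - (r +i* s)| <= 2 * `|s|.
  apply: norm_complex_le; first by rewrite mulr_ge0.
  rewrite exprMn real_normK ?num_real//; simpc => /=; move: rs r0; clear; nra.
have sc : `|s| * (4 * c) < 1 by rewrite -ltr_pdivlMr ?div1r//; lra.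
rewrite rnormZ; have := rnorm_ge0 k; have := normr_ge0 s.
move: w_le k1 c1 sc; clear; move: `|s| (rnorm k) (complex.Re _) => u v p.
move=> pu v1 c1 uc u0 v0.
have : p * v <= 2 * u by nra.
nra.
Qed.

(* Away from [w = 1] and [w = -1] the bound comes from [selfadj_resolvent];
   near these points, from perturbing [1 - k] and [1 + k]. *)
Lemma selfadj_circle_resolvent k y z :
    star k = k -> rnorm k <= 1 -> inverses (1 - k) y -> inverses (1 + k) z ->
  exists c, 1 <= c /\ forall w, `|w| = 1 ->
    exists x, inverses (1 - w *: k) x /\ rnorm x <= c.
Proof.
move=> kk k1 ky kz; pose c := 1 + rnorm y + rnorm z.
have y0 := rnorm_ge0 y; have z0 := rnorm_ge0 z.
have c1 : 1 <= c by rewrite /c; lra.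
exists (4 * c); split=> [|w w1]; first by lra.
have w0 : w != 0 by rewrite -normr_eq0 w1 oner_eq0.
have [b_ge|b_lt] := leP (4 * c)^-1 `|complex.Im w|.
  have b0 : 0 < `|complex.Im w| by rewrite (lt_le_trans _ b_ge)// invr_gt0; lra.
  have ImV : complex.Im w^-1 = - complex.Im w.
    by rewrite invc_norm w1 expr1n invr1 mul1r; case: (w).
  have [|x [kx x_le]] := @selfadj_resolvent R A k w^-1 kk.
    by rewrite ImV oppr_eq0 -normr_gt0.
  exists (w^-1 *: x); split.
    have -> : 1 - w *: k = w *: (sc w^-1 - k).
      by rewrite scalerBr scalerA divff// scale1r.
    exact: inversesZ.
  rewrite rnormZ normfV w1 invr1 mul1r (le_trans x_le)// ImV normrN.
  by rewrite -[leRHS]invrK lef_pV2 ?posrE// invr_gt0; lra.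
have [Re_ge0|Re_lt0] := leP 0 (complex.Re w).
  have [|x [kx x_le]] := inverses_near1 w1 Re_ge0 k1 ky c1 _ b_lt.
    by rewrite /c; lra.
  by exists x; split=> //; lra.
have w1' : `|- w| = 1 by rewrite normrN.
have Re_ge0 : 0 <= complex.Re (- w).
  by move: Re_lt0; case: (w) => r s /=; rewrite oppr_ge0; exact: ltW.
have b_lt' : `|complex.Im (- w)| < (4 * c)^-1.
  by move: b_lt; case: (w) => r s /=; rewrite normrN.
have [|||x [kx x_le]] := @inverses_near1 (- k) _ z _ w1' Re_ge0 _ _ c1 _ b_lt'.
- by rewrite rnormN.
- by rewrite opprK.
- by rewrite /c; lra.
by exists x; rewrite scaleNr scalerN opprK in kx; split=> //; lra.
Qed.

Lemma selfadj_boundary k y z : star k = k -> rnorm k = 1 ->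
  inverses (1 - k) y -> inverses (1 + k) z -> False.
Proof.
move=> kk k1 ky kz.
have [|c [c1 cP]] := selfadj_circle_resolvent kk _ ky kz; first by rewrite k1.
have c0 : 0 < c by lra.
(* Chosen so that the resolvent identity below gives the distance [c * e * (2 * c) = 1/4]. *)
pose e : R := (8 * c ^+ 2)^-1.
have e0 : 0 < e by rewrite invr_gt0 mulr_gt0// exprn_gt0.
have ec : c ^+ 2 * e = 8^-1 by rewrite /e; field; rewrite gt_eqF.
clearbody e.
have e1 : e < 1 by move: ec c1; clear -e0; nra.
have ec' : e * c <= 8^-1 by move: ec c1; clear -e0; nra.
pose q := (1 - e)%:C *: k.
have close : uniformly_close k q 4^-1.
  move=> w w1; have [x [kx x_le]] := cP _ w1.
  have dwk : 1 - w *: q - (1 - w *: k) = e%:C *: (w *: k).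
    rewrite opprB addrC subrKA /q scalerA mulrC -scalerA.
    by rewrite rmorphB rmorph1 scalerBl scale1r subKr.
  have dwk_le : rnorm (1 - w *: q - (1 - w *: k)) <= e.
    by rewrite dwk rnormZR gtr0_norm// rnormZ w1 k1 !mulr1.
  have [|x' [qx' x'_le]] := inverses_perturb (x' := 1 - w *: q) kx x_le.
    rewrite (le_trans (ler_wpM2r _ dwk_le)) ?(ltW c0)//; lra.
  exists x, x'; split=> //; rewrite (inverses_sub kx qx').
  rewrite (le_trans (rnormM _ _))// (le_trans (ler_wpM2r (rnorm_ge0 _) (rnormM
    _ _)))//.
  have -> : 4^-1 = c * e * (2 * c).
    transitivity (2 * (c ^+ 2 * e)); first by rewrite ec; field.
    by ring.
  by rewrite !ler_pM// ?mulr_ge0 ?rnorm_ge0.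
(* Since [n < 2^n], the bound 1/8 also holds for the exponent [2^n]. *)
have [n /(_ _ (leqnn _)) nP] : exists n, forall m, (n <= m)%N -> (1 - e) ^+ m
  <= 8^-1.
  by apply: exprn_small => //; rewrite subr_ge0 ltW//= gtrBl.
have s0 : 0 <= 1 - e by rewrite subr_ge0 ltW.
have {nP} qn_le : rnorm (q ^+ (2 ^ n)) <= 8^-1.
  rewrite (le_trans (rnormX _ _))// rnormZR k1 mulr1 ger0_norm //.
  rewrite (le_trans _ nP)//; apply: ler_wiXn2l.
  - exact: s0.
  - by rewrite gerBl ltW.
  - by rewrite ltnW// ltn_expl.
have kn1 : rnorm (k ^+ (2 ^ n)) = 1 by rewrite selfadj_rnormX// k1 expr1n.
have [|x [x' [kx qx' xx']]] := uniformly_closeX n close (w := 1).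
  by rewrite normr1.
rewrite scale1r in kx; rewrite scale1r in qx'.
(* From here [q] and [k] stand for their powers of exponent [2^n]. As [q] is small, [x'] is within
   1/7 of 1, so [x] is within 1/7 + 1/4 = 11/28 of 1. Hence [1 - k], the inverse of [x], has norm at
   most 28/17, and [-k = (1 - k)(1 - x)] has norm at most 11/17, against [|k| = 1]. *)
move: (q ^+ (2 ^ n)) (k ^+ (2 ^ n)) qn_le kn1 kx qx'.
move=> {close ky kz k1 kk cP}q {}k q_le k1 kx qx'.
have [|u [qu u_le]] := @neumann R A q; first by rewrite (le_lt_trans q_le)//;
  lra.
rewrite (inverses_uniq qu qx') in u_le.
have x'_le : rnorm x' <= 8 / 7.
  by rewrite (le_trans u_le)// -div1r ler_pdivrMr; lra.
have x'1 : rnorm (x' - 1) <= 7^-1.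
  have -> : x' - 1 = q * x' by rewrite -(proj1 qx') mulrBl mul1r subKr.
  by rewrite (le_trans (rnormM _ _))//; have := rnorm_ge0 x'; have := rnorm_ge0
    q; nra.
have x1 : rnorm (1 - x) <= 11 / 28.
  by rewrite rnorm_distC; have := rnorm_distD x' x 1; lra.
have [|v [xv v_le]] := @neumann R A (1 - x).
  by rewrite (le_lt_trans x1)//; lra.
rewrite subKr in xv; rewrite -(inverses_uniq (inverses_sym kx) xv) in v_le.
have {}v_le : rnorm (1 - k) <= 28 / 17.
  by rewrite (le_trans v_le)// -div1r ler_pdivrMr; lra.
have kE : - k = (1 - k) * (1 - x).
  by rewrite mulrBr mulr1 (proj1 kx) addrAC subrr sub0r.
have := rnormM (1 - k) (1 - x); rewrite -kE rnormN k1.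
have := rnorm_ge0 (1 - k); have := rnorm_ge0 (1 - x); nra.
Qed.

(** If [t = |h|] exceeded [c], neither [t] nor [-t] would be spectral, and [h / t] would contradict
    [selfadj_boundary]. *)
Lemma selfadj_norm_le h (c : R) : star h = h -> 0 <= c ->
    (forall r, ~ cinvertible (sc r%:C - h) -> `|r| <= c) -> rnorm h <= c.
Proof.
move=> hh c0 hc; rewrite leNgt; apply/negP => c_lt.
pose t := rnorm h; have t0 : 0 < t by exact: le_lt_trans c_lt.
have tC0 : t%:C != 0 by apply: contraTneq t0 => /complexI ->; rewrite ltxx.
have inv r : `|r| = t -> exists y, inverses (sc r%:C - h) y.
  by move=> rt; apply: contrapT => /hc; rewrite rt leNgt c_lt.
have [|y hy] := inv t; first by rewrite gtr0_norm.
have [|z hz] := inv (- t); first by rewrite normrN gtr0_norm.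
pose k := (t%:C)^-1 *: h.
have kk : star k = k by rewrite /k -fmorphV starZR hh.
have k1 : rnorm k = 1.
  by rewrite /k -fmorphV rnormZR gtr0_norm ?invr_gt0// mulVf ?gt_eqF.
apply: (selfadj_boundary (k := k) kk k1).
  have -> : 1 - k = (t%:C)^-1 *: (sc t%:C - h).
    by rewrite scalerBr scalerA mulVf// scale1r.
  by apply: inversesZ hy; rewrite invr_eq0.
have -> : 1 + k = (- t%:C)^-1 *: (sc (- t)%:C - h).
  by rewrite scalerBr scalerA rmorphN mulVf ?oppr_eq0// scale1r invrN scaleNr
    opprK.
by apply: inversesZ hz; rewrite invr_eq0 oppr_eq0.
Qed.

(** * The positive cone: norm criterion, sums, limits, monotonicity *)

Lemma cinvertibleN a : cinvertible (- a) -> cinvertible a.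
Proof.
move=> [b [ab ba]]; exists (- (b : cring A)); split.
  by have := ab : - a * (b : cring A) = 1; rewrite mulNr -mulrN.
by have := ba : (b : cring A) * - a = 1; rewrite mulrN -mulNr.
Qed.

Lemma spectrum_norm_le a l : ~ cinvertible (sc l - a) -> complex.Re `|l| <=
  rnorm a.
Proof.
move=> nla; rewrite leNgt; apply/negP => al; apply: nla.
have l0 : l != 0.
  by apply: contraTneq al => ->; rewrite normr0 -leNgt rnorm_ge0.
have l0' : 0 < complex.Re `|l| by rewrite (le_lt_trans _ al) ?rnorm_ge0.
have [|y [ly _]] := @neumann R A (l^-1 *: a).
  by rewrite rnormZ normfV normcRe -fmorphV /= mulrC ltr_pdivrMr// mul1r.
exists (l^-1 *: y : cring A).
have -> : sc l - a = l *: (1 - l^-1 *: a) by rewrite scalerBr scalerA divff//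
  scale1r.
exact: inversesZ.
Qed.

Lemma selfadj_spectrum_real h l : star h = h -> ~ cinvertible (sc l - h) ->
  l = (complex.Re l)%:C.
Proof.
move=> hh hl; case: (eqVneq (complex.Im l) 0) => [|l0].
  by case: l {hl} => r s /= ->.
by have [y [hy _]] := selfadj_resolvent hh l0; case: hl; exists y.
Qed.

Lemma star_scR r : star (sc r%:C) = sc r%:C.
Proof. by rewrite starZR star1. Qed.

(** The spectrum of [a] lies between 0 and [t], hence so does that of [t - a], and the spectrum
    controls the norm. *)
Lemma cpositive_dist a t : cpositive a -> rnorm a <= t -> rnorm (sc t%:C - a)
  <= t.
Proof.
move=> [aa pos] at_; have t0 := le_trans (rnorm_ge0 a) at_.
apply: selfadj_norm_le => // [|r nr]; first by rewrite starB star_scR [star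
  a]aa.
have nr' : ~ cinvertible (sc (t - r)%:C - a).
  move=> ar; apply: nr; apply: cinvertibleN; rewrite !opprB addrAC.
  by rewrite -scalerBl -rmorphB.
have := pos _ nr'; rewrite ler0c => r_le.
have := spectrum_norm_le nr'; rewrite normc_def /= expr0n addr0 sqrtr_sqr.
by move: r_le at_ t0; rewrite !ler_norml; lra.
Qed.

(** A spectral point [l] of [a] is real, and [t - l] is spectral for [t - a]; so [|t - l| <= t],
    which forces [l >= 0]. *)
Lemma dist_cpositive a t : star a = a -> rnorm (sc t%:C - a) <= t -> cpositive
  a.
Proof.
move=> aa at_; split=> // l nl.
have lE := selfadj_spectrum_real aa nl; rewrite lE ler0c.
have {}nl : ~ cinvertible (sc (t - complex.Re l)%:C - (sc t%:C - a)).
  move=> ar; apply: nl; apply: cinvertibleN; move: ar.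
  rewrite rmorphB scalerBl opprB addrC subrKA /=.
  by rewrite -lE opprB.
have := le_trans (spectrum_norm_le nl) at_.
by rewrite normc_def /= expr0n addr0 sqrtr_sqr ler_norml; lra.
Qed.

(** By the norm criterion at [t = |a| + |b|] this is the triangle inequality. *)
Lemma cpositiveD a b : cpositive a -> cpositive b -> cpositive (a + b).
Proof.
move=> pa pb; apply: (dist_cpositive (t := rnorm a + rnorm b)).
  by rewrite starD [star a](proj1 pa) [star b](proj1 pb).
rewrite rmorphD scalerDl opprD addrACA (le_trans (rnormD _ _))//.
by rewrite lerD ?cpositive_dist.
Qed.

Lemma cpositive0 : @cpositive R A 0.
Proof.
apply: (@dist_cpositive 0 0); last by rewrite scale0r subrr rnorm0.
by apply: (addrI (star 0)); rewrite -starD !addr0.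
Qed.

Lemma cpositiveZ r a : 0 <= r -> cpositive a -> cpositive (r%:C *: a).
Proof.
move=> r0 pa; apply: (dist_cpositive (t := r * rnorm a)).
  by rewrite starZR [star a](proj1 pa).
by rewrite rmorphM -scalerA -scalerBr rnormZR ger0_norm// ler_wpM2l//
  cpositive_dist.
Qed.

Lemma cpositive_lim (u : nat -> A) (v : A) : (forall n, cpositive (u n)) ->
  u @ \oo --> v -> cpositive v.
Proof.
move=> pu uv; have /cvgn_rnormP uv' := uv.
have vv : star v = v.
  apply/eqP; rewrite -subr_eq0; apply/eqP/rnorm_eq0/eqP; rewrite eq_le
    rnorm_ge0 andbT.
  apply/ler_addgt0Pr => e e0; rewrite add0r.
  have [|n /(_ n (leqnn n)) nP] := uv' (e / 2); first by rewrite divr_gt0.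
  have uu : star (u n) = u n := proj1 (pu n).
  rewrite (le_trans (rnorm_distD (u n) _ _))// [leRHS]splitr lerD//.
  by rewrite -{1}uu -starB rnorm_star rnorm_distC.
have [n nP] := uv' 1 ltr01.
(* Eventually [|u m| <= 1 + |v|], so one [t] serves the whole tail and the norm criterion survives
   the limit. *)
apply: (dist_cpositive (t := 1 + rnorm v)) => //.
apply: (rnorm_lim_le (n := n)) uv _ => m /nP nm.
by rewrite cpositive_dist//; have := rnormD (u m - v) v; rewrite subrK; lra.
Qed.

(** With [t = |b|], both [t - b] and [b - a] are positive, hence so is [t - a]; the spectrum of [a]
    is then bounded by [t]. *)
Lemma cpositive_norm_le a b : cpositive a -> cle a b -> rnorm a <= rnorm b.
Proof.
move=> pa ab; have pb : cpositive b by rewrite -[b](subrK a); exact: cpositiveD.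
set t := rnorm b.
have ptb : cpositive (sc t%:C - b).
  apply: (dist_cpositive (t := t)); first by rewrite starB star_scR [star
    b](proj1 pb).
  by rewrite subKr.
have [_ pta] : cpositive (sc t%:C - a) by rewrite -(subrKA b); exact:
  cpositiveD.
apply: selfadj_norm_le; [exact: (proj1 pa)|exact: rnorm_ge0|] => r nr.
have := proj2 pa _ nr; rewrite ler0c => r0; rewrite ger0_norm//.
have := pta (t - r)%:C; rewrite ler0c subr_ge0; apply => ar; apply: nr.
apply: cinvertibleN; move: ar; rewrite -/(cinvertible _).
by rewrite rmorphB scalerBl opprB addrC subrKA opprB.
Qed.

End Spectrum.

(** * Sums of inner products in the Hilbert module *)

Section Frames.
Context {R : realType} {A : cstarAlgType R} {H : hilbertModType A}.
Implicit Types (u v : H) (x y : nat -> H) (J : set nat) (r s : R).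

Definition sqip u : cring A := hip u u.

Definition range_sum J x n m : cring A := \sum_(n <= i < m | i \in J) sqip (x
  i).

Lemma hipDr u v v' : hip u (v + v') = hip u v + hip u v'.
Proof. by rewrite hipC hipDl cstarD -!hipC. Qed.

Lemma hipNl u v : hip (- u) v = - hip u v.
Proof.
apply: (addIr (hip u v)); rewrite -hipDl !addNr; apply: (addrI (hip 0 v)).
by rewrite -hipDl !addr0.
Qed.

Lemma hipNr u v : hip u (- v) = - hip u v.
Proof. by rewrite hipC hipNl [LHS]starN [in RHS]hipC. Qed.

(** Both sides expand to [s <u,u> + s <u,v> + s <v,u> + <v,v>]. Real scalars act on [H] through
    multiples of the unit of [A]. *)
Lemma sqip_comb s u v :
  sqip ((s%:C *: (1 : cring A)) *: u + v) + (s - s ^+ 2)%:C *: sqip u =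
  s%:C *: sqip (u + v) + (1 - s)%:C *: sqip v.
Proof.
have hZl w w' : hip ((s%:C *: (1 : cring A)) *: w) w' = s%:C *: (hip w w' :
  cring A).
  by rewrite hipZl -[LHS]scaler_mull mul1r.
have hZr w w' : hip w ((s%:C *: (1 : cring A)) *: w') = s%:C *: (hip w w' :
  cring A).
  by rewrite hipC hZl [LHS]starZR -[star _]hipC.
rewrite /sqip !hipDl !hipDr hZl !hZr hZl.
set uu : cring A := hip u u; set vv : cring A := hip v v.
set uv : cring A := hip u v; set vu : cring A := hip v u.
have -> : s%:C *: (s%:C *: uu) + s%:C *: uv + (s%:C *: vu + vv) +
    (s - s ^+ 2)%:C *: uu = s%:C *: uu + s%:C *: uv + (s%:C *: vu + vv).
  rewrite addrAC -[X in X + _ = _]addrA [s%:C *: uv + _]addrC addrA scalerA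
    -scalerDl.
  by rewrite -rmorphM -rmorphD -expr2 subrKC.
rewrite !scalerDr -!addrA; congr (_ + (_ + (_ + _))).
by rewrite -scalerDl -rmorphD subrKC scale1r.
Qed.

Lemma range_sum_ge0 J x n m : cpositive (range_sum J x n m : A).
Proof.
rewrite /range_sum; apply: (big_ind (fun a : cring A => cpositive (a : A))).
- exact: cpositive0.
- by move=> a b; exact: cpositiveD.
- by move=> i _; exact: hip_ge0.
Qed.

Lemma range_sum_comb s J x y n m :
  cpositive (s%:C *: range_sum J (fun i => x i + y i) n m +
    (1 - s)%:C *: range_sum J y n m - (s - s ^+ 2)%:C *: range_sum J x n m : A).
Proof.
have -> : s%:C *: range_sum J (fun i => x i + y i) n m +
    (1 - s)%:C *: range_sum J y n m - (s - s ^+ 2)%:C *: range_sum J x n m =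
    range_sum J (fun i => (s%:C *: (1 : cring A)) *: x i + y i) n m.
  rewrite /range_sum !scaler_sumr -!big_split -sumrB /=; apply: eq_bigr => i _.
  by rewrite -sqip_comb addrK.
exact: range_sum_ge0.
Qed.

Lemma ip_psumB J x n m : (n <= m)%N ->
  ip_psum J x m - ip_psum J x n = range_sum J x n m.
Proof.
by move=> nm; rewrite /ip_psum (big_cat_nat (leq0n n) nm) addrC addKr.
Qed.

Lemma ell2P J x : ell2 J x <-> forall e : R, 0 < e ->
  exists n, forall m, (n <= m)%N -> rnorm (range_sum J x n m) <= e.
Proof.
split=> [/is_cvgn_rnormP cv e /cv[n nP]|cv].
  by exists n => m nm; rewrite -ip_psumB// nP.
apply/is_cvgn_rnormP => e /cv[n nP].
by exists n => m nm; rewrite (ip_psumB _ _ nm) nP.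
Qed.

(** Dropping initial positive terms decreases the sum. This allows Cauchy estimates with different
    starting indices to be combined. *)
Lemma range_sum_tail J x n k m : (n <= k <= m)%N ->
  rnorm (range_sum J x k m) <= rnorm (range_sum J x n m).
Proof.
move=> /andP[nk km]; apply: cpositive_norm_le; first exact: range_sum_ge0.
rewrite /cle {1}/range_sum (big_cat_nat nk km) addrK; exact: range_sum_ge0.
Qed.

Lemma ell2D J x y : ell2 J x -> ell2 J y -> ell2 J (fun i => x i + y i).
Proof.
move=> /ell2P xP /ell2P yP; apply/ell2P => e e0.
have [|n nP] := xP (e / 4); first by rewrite divr_gt0.
have [|k kP] := yP (e / 4); first by rewrite divr_gt0.
exists (maxn n k) => m; rewrite geq_max => /andP[nm km].
(* The case [s = -1]: [<x + y, x + y> <= 2 <x, x> + 2 <y, y>], termwise summed; the factors 2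
   account for [e / 4] above. *)
have xy_le : cle (range_sum J (fun i => x i + y i) (maxn n k) m)
    (2%:C *: range_sum J y (maxn n k) m + 2%:C *: range_sum J x (maxn n k) m).
  have := range_sum_comb (-1) J x y (maxn n k) m.
  have -> : (-1) - (-1) ^+ 2 = - 2 :> R by ring.
  have -> : 1 - (-1) = 2 :> R by ring.
  rewrite !rmorphN rmorph1 scaleN1r scaleNr opprK -addrA addrC; exact.
apply: (le_trans (cpositive_norm_le (range_sum_ge0 _ _ _ _) xy_le)).
rewrite (le_trans (rnormD _ _))// !rnormZR !ger0_norm//.
have x_le : rnorm (range_sum J x (maxn n k) m) <= rnorm (range_sum J x n m).
  by apply: range_sum_tail; rewrite leq_maxl geq_max nm.
have y_le : rnorm (range_sum J y (maxn n k) m) <= rnorm (range_sum J y k m).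
  by apply: range_sum_tail; rewrite leq_maxr geq_max nm.
by have := nP m nm; have := kP m km; lra.
Qed.

Lemma ip_sum_comb s J x y : ell2 J x -> ell2 J y ->
  cpositive (s%:C *: ip_sum J (fun i => x i + y i) +
    (1 - s)%:C *: ip_sum J y - (s - s ^+ 2)%:C *: ip_sum J x).
Proof.
move=> cx cy; have cxy := ell2D cx cy.
apply: (cpositive_lim (u := s%:C \*: ip_psum J (fun i => x i + y i) +
    (1 - s)%:C \*: ip_psum J y - (s - s ^+ 2)%:C \*: ip_psum J x)).
  by move=> n; exact: (range_sum_comb s J x y 0 n).
by apply: cvgB; [apply: cvgD|]; apply: cvgZl_tmp.
Qed.

(** * Perturbation of an operator frame by a Bessel sequence *)

Lemma adjointableD (T S : H -> H) :
  adjointable T -> adjointable S -> adjointable (fun u => T u + S u).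
Proof.
move=> [T' TT'] [S' SS']; exists (fun u => T' u + S' u) => u v.
by rewrite hipDl TT' SS' hipDr.
Qed.

Lemma adjointableN (T : H -> H) : adjointable T -> adjointable (fun u => - T u).
Proof.
move=> [T' TT']; exists (fun u => - T' u) => u v.
by rewrite hipNl TT' hipNr.
Qed.

(** Isolates three groups that are each positive when applied: the combination of [ip_sum_comb], a
    frame inequality for [U], and the Bessel inequality for [V]. *)
Lemma comb_split (s t1 t2 a m : R[i]) (W U V X : A) :
  s *: W - (t1 * a - t2 * m) *: X =
  (s *: W + t2 *: V - t1 *: U) + t1 *: (U - a *: X) + t2 *: (m *: X - V).
Proof.
rewrite !scalerBr !scalerA subrKA scalerBl opprB.
move: (s *: W) (t2 *: V) ((t1 * a) *: X) ((t2 * m) *: X) => {W U V X}p q x z.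
by rewrite [in RHS]addrAC [z - q]addrC addrA addrK addrA addrAC.
Qed.

Lemma operator_frameD J (T S : nat -> H -> H) (a b m : R) :
  operator_frame_bounds J T a b -> operator_bessel_bound J S m -> m < a ->
  operator_frame J (fun i u => T i u + S i u).
Proof.
move=> [a0 b0 adjT frT] [m0 adjS besS] ma.
(* The lower estimate has coefficient [(s - s^2) a - (1 - s) m = (1 - s)(s a - m)], positive for
   [m / a < s < 1]; [s] is the midpoint of that interval. *)
pose s := (a + m) / (2 * a).
have sa : s * (2 * a) = a + m by rewrite /s divfK// mulf_neq0// gt_eqF.
have s0 : 0 < s by rewrite divr_gt0 ?addr_gt0 ?mulr_gt0.
have s1 : s < 1 by rewrite ltr_pdivrMr ?mulr_gt0// mul1r; lra.
pose a' := ((s - s ^+ 2) * a - (1 - s) * m) / s.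
have a'0 : 0 < a'.
  apply: divr_gt0 => //.
  have -> : (s - s ^+ 2) * a - (1 - s) * m = (1 - s) * ((a - m) / 2).
    by rewrite (_ : (a - m) / 2 = s * a - m); [ring | lra].
  by rewrite mulr_gt0 ?divr_gt0 ?subr_gt0.
exists a', (2 * (b + m)); split=> //.
- by rewrite mulr_gt0// addr_gt0.
- by move=> i Ji; exact: adjointableD (adjT i Ji) (adjS i Ji).
move=> u; have [cT T_ge T_le] := frT u; have [cS S_le] := besS u.
split.
- exact: ell2D.
- have comb := ip_sum_comb s cT cS; set W := ip_sum J _ in comb *.
  have -> : cle (a'%:C *: hip u u) W = cpositive ((s^-1)%:C *:
      (s%:C *: W - ((s - s ^+ 2)%:C * a%:C - (1 - s)%:C * m%:C) *: hip u u)).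
    rewrite scalerBr !scalerA -!rmorphM -rmorphB -rmorphM mulVf ?gt_eqF//
      scale1r.
    by rewrite mulrC.
  apply: cpositiveZ; first by rewrite invr_ge0 ltW.
  rewrite (comb_split _ _ _ _ _ _ (ip_sum J (T^~ u)) (ip_sum J (S^~ u))).
  apply: cpositiveD; [apply: cpositiveD => //|]; apply: cpositiveZ => //.
    by rewrite expr2 -[X in X - _]mulr1 -mulrBr mulr_ge0 ?subr_ge0 ?ltW.
  by rewrite subr_ge0 ltW.
(* At [s = -1] the coefficient of the [T]-sum is negative, so the upper frame bound [b] enters. *)
- have comb := ip_sum_comb (-1) cT cS; set W := ip_sum J _ in comb *.
  have -> : cle W ((2 * (b + m))%:C *: hip u u) = cpositive (
      (-1)%:C *: W - ((-2)%:C * b%:C - 2%:C * m%:C) *: hip u u).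
    rewrite -!rmorphM -rmorphB rmorphN1 scaleN1r -scaleNr -rmorphN [- W +
      _]addrC.
    by have -> : - (- 2 * b - 2 * m) = 2 * (b + m) by ring.
  rewrite (comb_split _ _ _ _ _ _ (ip_sum J (T^~ u)) (ip_sum J (S^~ u))).
  have e1 : -1 - (-1) ^+ 2 = -2 :> R by ring.
  have e2 : 1 - (-1) = 2 :> R by ring.
  rewrite e1 e2 in comb.
  apply: cpositiveD; [apply: cpositiveD => //|]; last exact: cpositiveZ.
  by rewrite rmorphN scaleNr -scalerN opprB; exact: cpositiveZ.
Qed.

(** Signs cancel in [<-S x, -S x>]; this reduces differences to sums. *)
Lemma operator_bessel_boundN J (S : nat -> H -> H) (m : R) :
  operator_bessel_bound J S m -> operator_bessel_bound J (fun i u => - S i u) m.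
Proof.
move=> [m0 adjS besS]; split=> // [i Ji|u]; first exact: adjointableN (adjS i
  Ji).
have psumE : ip_psum J (fun i => - S i u) = ip_psum J (fun i => S i u).
  apply/funext => n; apply: eq_bigr => i _.
  by rewrite hipNl hipNr opprK.
by rewrite /ell2 /ip_sum psumE; exact: besS.
Qed.

End Frames.

Theorem theorem3p1 (R : realType) (A : cstarAlgType R) (H : hilbertModType A)
    (J : set nat) (T S : nat -> H -> H) (a b m : R)
    (frameT : operator_frame_bounds J T a b)
    (besselS : operator_bessel_bound J S m)
    (lt_ma : m < a) :
  operator_frame J (fun i x => T i x + S i x) /\
  operator_frame J (fun i x => T i x - S i x).
Proof.
split; first exact: operator_frameD frameT besselS lt_ma.
exact: operator_frameD frameT (operator_bessel_boundN besselS) lt_ma.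
Qed.
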